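(* If $S \subsetneq \mathbb{Z}^2$ is B-stable (in particular, if $S$ is BI-stable), then $\underline{\gamma}(S) \le 1/9$ and $\overline{\delta}(S) \le (1 - \underline{\gamma}(S))/4$. Moreover, there is a BI-stable set $S \subsetneq \mathbb{Z}^2$ with $\underline{\gamma}(S) = 1/9$ and $\overline{\delta}(S) = 2/9$, and a BI-stable set $S' \subsetneq \mathbb{Z}^2$ with $\underline{\gamma}(S') = 0$ and $\overline{\delta}(S') = 1/4$.
   Context: A lattice triangle is the convex hull in $\mathbb{R}^2$ of three non-collinear points of $\mathbb{Z}^2$. A triangle is a set $T = \Delta \cap \mathbb{Z}^2$ for a lattice triangle $\Delta$. A triangle is minimal if it contains exactly $4$ points of $\mathbb{Z}^2$; a minimal triangle is a border triangle if its non-vertex point lies on the boundary of $\Delta$, and an internal triangle if that point lies in the interior of $\Delta$. A set $S \subseteq \mathbb{Z}^2$ is B-stable if no border triangle has exactly three of its points in $S$; I-stable if no internal triangle has exactly three of its points in $S$; BI-stable if both. For integers $a \le b$, $[a,b] = \{i \in \mathbb{Z}: a \le i \le b\}$. The upper density of $X \subseteq \mathbb{Z}^2$ is $\overline{\delta}(X) = \limsup_{n\to\infty} |X \cap [-n,n]^2|/|[-n,n]^2|$. Let $\Gamma(X)$ be the set of $(x,y) \in X$ with $(x+1,y) \in X$, and define the lower consecutive density $\underline{\gamma}(X) = \liminf_{n\to\infty} |\Gamma(X) \cap [-n,n]^2|/|[-n,n]^2|$. *)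

(* Defs.v *)
From HB Require Import structures.
From mathcomp Require Import all_boot all_order all_algebra finmap.
From mathcomp Require Import all_classical all_reals all_analysis.

Set Implicit Arguments.
Unset Strict Implicit.
Unset Printing Implicit Defensive.

Import Order.TTheory GRing.Theory Num.Theory.
Import numFieldNormedType.Exports.

Local Open Scope classical_set_scope.
Local Open Scope card_scope.
Local Open Scope ring_scope.

Notation Z2 := (int * int)%type.

Definition embZ2 (R : realType) (p : Z2) : R * R := (p.1%:~R, p.2%:~R).

Definition collinear (R : realType) (A : set (R * R)) : Prop :=
  exists p d : R * R, d != 0 /\ A `<=` [set p + t *: d | t in [set: R]].

Definition convex_hull (R : realType) (A : set (R * R)) : set (R * R) :=
  smallest (fun C : set (R * R) => convex_set C) A.

Definition boundary (T : topologicalType) (A : set T) : set T :=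
  closure A `\` interior A.

Definition vertices (R : realType) (a b c : Z2) : set (R * R) :=
  embZ2 R @` [set a; b; c].
Arguments vertices R a b c : clear implicits.

Definition lattice_points (R : realType) (D : set (R * R)) : set Z2 :=
  embZ2 R @^-1` D.

(* [T] is the set of lattice points of a lattice triangle [D] containing
   exactly 4 lattice points, the non-vertex one lying in the set [loc D]. *)
Definition minimal_triangle_with (R : realType) (loc : set (R * R) -> set (R * R))
    (T : set Z2) : Prop :=
  exists a b c : Z2,
    let D := convex_hull (vertices R a b c) in
    [/\ ~ collinear (vertices R a b c),
        T = lattice_points D,
        T #= `I_4 &
        exists p : Z2, [/\ T p, ~ [set a; b; c] p & loc D (embZ2 R p)]].

Definition border_triangle (R : realType) : set Z2 -> Prop :=
  @minimal_triangle_with R (@boundary _).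

Definition internal_triangle (R : realType) : set Z2 -> Prop :=
  @minimal_triangle_with R (@interior _).

Definition B_stable (R : realType) (S : set Z2) : Prop :=
  forall T, border_triangle R T -> ~ (T `&` S #= `I_3).

Definition I_stable (R : realType) (S : set Z2) : Prop :=
  forall T, internal_triangle R T -> ~ (T `&` S #= `I_3).

Definition BI_stable (R : realType) (S : set Z2) : Prop :=
  B_stable R S /\ I_stable R S.

Definition box (n : nat) : set Z2 :=
  [set` `[- n%:Z, n%:Z]%R] `*` [set` `[- n%:Z, n%:Z]%R].

Definition box_density (R : realType) (X : set Z2) (n : nat) : R :=
  (#|` fset_set (X `&` box n)|)%:R / (#|` fset_set (box n)|)%:R.

Definition upper_density (R : realType) (X : set Z2) : R :=
  limn_sup (box_density R X).

Definition consecutive (X : set Z2) : set Z2 :=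
  [set p | X p /\ X (p.1 + 1, p.2)].

Definition lower_consecutive_density (R : realType) (X : set Z2) : R :=
  limn_inf (box_density R (consecutive X)).

(* Main.v *)
Require Import Defs.
From HB Require Import structures.
From mathcomp Require Import all_boot all_order all_algebra finmap.
From mathcomp Require Import all_classical all_reals all_analysis.
From mathcomp Require Import zify ring lra.

Set Implicit Arguments.
Unset Strict Implicit.
Unset Printing Implicit Defensive.

Import Order.TTheory GRing.Theory Num.Theory.
Import numFieldNormedType.Exports.

(* If det(u, v) = 1 or -1, then {p - u, p, p + u, p + v} is a border triangle.
   Hence a proper B-stable set S contains no three consecutive points on a
   lattice line (they would force the two adjacent lines, and then everything,
   into S); two points of S at lattice distance 1 or 2 on a line force the
   adjacent lines to be empty, and two consecutive points even empty the lines
   at distance 2.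

   Cut a box of side N into rows and group them greedily from below.  A row with
   a consecutive pair is followed by two empty rows, a row with a gap X.X by one
   empty row, and every other nonempty row is sparse, with gaps at least 3.  If
   A0, A1, A2 are consecutive rows, with A0 and A1 sparse and a in A2, then A0
   and 2 A1 - a are at mutual distance at least 3, so A0 and A1 together contain
   at most N/2 + O(1) points.  In each block of k rows this yields
   4 |S| + |consecutive S| <= k (N + O(1)), and summing the blocks gives the
   density bounds.  They are attained by the points with y = 0 and x = 0 or 1
   modulo 3, and by (2Z)^2: three points of a minimal triangle in one of these
   sets would create too many, or only collinear, lattice points. *)

(** * Counting in rows *)

Lemma sum_nat_cat (f : nat -> nat) m n p : (m <= n)%N -> (n <= p)%N ->
  \sum_(m <= i < p) f i = (\sum_(m <= i < n) f i + \sum_(n <= i < p) f i)%N.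
Proof. exact: big_cat_nat. Qed.

Lemma sum_nat2 (f : nat -> nat) t :
  \sum_(t <= i < t + 2) f i = (f t + f t.+1)%N.
Proof. by rewrite addn2 big_nat_recr ?big_nat1. Qed.

Lemma sum_nat3 (f : nat -> nat) t :
  \sum_(t <= i < t + 3) f i = (f t + f t.+1 + f t.+2)%N.
Proof. by rewrite addn3 big_nat_recr ?(leqW (leqW _))// -addn2 sum_nat2. Qed.

(** The interval is cut into windows of length [d]; a nonempty remainder counts as one more full
    window, whence [m + d.-1] in place of [m]. *)
Lemma sum_window_le (f : nat -> nat) (d c : nat) : (0 < d)%N ->
  (forall x, \sum_(x <= i < x + d) f i <= c)%N ->
  forall x m, (d * \sum_(x <= i < x + m) f i <= c * (m + d.-1))%N.
Proof.
move=> d0 fc x m; have [k] := ubnP m.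
elim: k m x => // k IH m x mk; case: (leqP d m) => [dm|md]; last first.
  case: m md mk => [|m] md mk; first by rewrite addn0 big_geq// muln0.
  have := fc x; rewrite (@sum_nat_cat _ x (x + m.+1)); [|lia..].
  by nia.
rewrite (@sum_nat_cat _ x (x + d)); [|lia..].
have h1 := fc x; have := IH (m - d)%N (x + d)%N ltac:(lia).
rewrite -addnA subnKC//; nia.
Qed.

Lemma sum_window_ge (f : nat -> nat) (d c : nat) : (0 < d)%N ->
  (forall x, c <= \sum_(x <= i < x + d) f i)%N ->
  forall x m, (c * m <= d * \sum_(x <= i < x + m) f i + c * d)%N.
Proof.
move=> d0 fc x m; have [k] := ubnP m.
elim: k m x => // k IH m x mk; case: (leqP d m) => [dm|md]; last by nia.
rewrite (@sum_nat_cat _ x (x + d)); [|lia..].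
have h1 := fc x; have := IH (m - d)%N (x + d)%N ltac:(lia).
rewrite -addnA subnKC//; nia.
Qed.

Definition sparse (P : pred nat) :=
  forall i, ~~ (P i && P i.+1) /\ ~~ (P i && P i.+2).

Lemma sparse_count (P : pred nat) : sparse P ->
  forall x m, (3 * \sum_(x <= i < x + m) P i <= m + 2)%N.
Proof.
move=> sP x m; rewrite -[leqRHS]mul1n; apply: (@sum_window_le _ 3 1) => // {}x.
rewrite sum_nat3.
have := sP x; have := sP x.+1.
by case: (P x); case: (P x.+1); case: (P x.+2) => //= -[] // ? ? [].
Qed.

Lemma sparseP (P : pred nat) i j : sparse P -> P i -> P j ->
  [\/ i = j, (i + 3 <= j)%N | (j + 3 <= i)%N].
Proof.
move=> sP Pi Pj; case: (ltngtP i j) => [ij|ji|->]; last exact: Or31.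
- have [|h] := leqP (i + 3) j; first by move=> _; apply: Or32.
  have [] : j = i.+1 \/ j = i.+2 by lia.
    by move=> e; case: (sP i); rewrite Pi -e Pj.
  by move=> e; case: (sP i); rewrite Pi -e Pj.
- have [|h] := leqP (j + 3) i; first by move=> _; apply: Or33.
  have [] : i = j.+1 \/ i = j.+2 by lia.
    by move=> e; case: (sP j); rewrite Pj -e Pi.
  by move=> e; case: (sP j); rewrite Pj -e Pi.
Qed.

Section three_rows.
Variables (A B : pred nat) (k : nat).
Hypotheses (sA : sparse A) (sB : sparse B).
Hypothesis AB : forall i j, A i -> B j ->
  (i + k + 3 <= 2 * j)%N \/ (2 * j + 3 <= i + k)%N.

(** [C] is the image of [B] under [j -> 2 * j - k], cut to the natural numbers. For a point [k] in
    the row above that of [B], this map gives the point of the row below that is collinear with [j]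
    and [k]. *)
Let C i := ~~ odd (i + k) && B (i + k)./2.

Let AC i j : A i -> C j -> (i + 3 <= j)%N \/ (j + 3 <= i)%N.
Proof.
move=> Ai /andP[ev Bj]; have := AB Ai Bj.
have := odd_double_half (j + k); rewrite (negbTE ev) -mul2n; lia.
Qed.

Let CC i j : C i -> C j -> [\/ i = j, (i + 3 <= j)%N | (j + 3 <= i)%N].
Proof.
move=> /andP[ei Bi] /andP[ej Bj]; have := sparseP sB Bi Bj.
have := odd_double_half (j + k); rewrite (negbTE ej) -mul2n.
have := odd_double_half (i + k); rewrite (negbTE ei) -mul2n.
by move=> h1 h2 [] h; [apply: Or31|apply: Or32|apply: Or33]; lia.
Qed.

Let sparse_union : sparse (fun i => A i || C i).
Proof.
suff h i j : A i || C i -> A j || C j -> (i < j)%N -> (i + 3 <= j)%N.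
  by move=> i; split; apply/negP => /andP[] /h /[apply]; lia.
move=> /orP[] hi /orP[] hj ij.
- by have [] := sparseP sA hi hj; lia.
- by have [] := AC hi hj; lia.
- by have [] := AC hj hi; lia.
- by have [] := CC hi hj; lia.
Qed.

(** [C] lives on the indices with the parity of [k], and [odd k + 2 * m + k] is twice
    [uphalf k + m]. *)
Let sumC m : \sum_(odd k <= i < odd k + 2 * m) (C i : nat) =
  \sum_(uphalf k <= j < uphalf k + m) (B j : nat).
Proof.
elim: m => [|m IH]; first by rewrite !addn0 !big_geq.
rewrite (_ : odd k + 2 * m.+1 = (odd k + 2 * m).+2)%N; last lia.
rewrite addnS !big_nat_recr/=; [|lia..].
rewrite IH -addnA; congr (_ + _)%N.
have e : (odd k + 2 * m + k)%N = (2 * (uphalf k + m))%N.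
  by rewrite uphalf_half -[in RHS]add1n; have := odd_double_half k; rewrite -mul2n; lia.
by rewrite /C addSn e mul2n oddS odd_double doubleK/= addn0.
Qed.

(* [A] together with [2 B - k] is again 3-sparse; the part of [B] which this
   map sends outside of the window has length about [n]. *)
Lemma sparse_pair_count n : (k <= 2 * n)%N ->
  (3 * (\sum_(0 <= i < (2 * n).+1) A i + \sum_(0 <= i < (2 * n).+1) B i)
    <= 3 * n + 8)%N.
Proof.
move=> kn.
have hk : (uphalf k <= n)%N by lia.
rewrite (@sum_nat_cat B 0 (uphalf k)); [|lia..].
rewrite (@sum_nat_cat B (uphalf k) (uphalf k + n)); [|lia..].
rewrite -sumC.
have h1 := sparse_count sB 0 (uphalf k).
have h2 := sparse_count sB (uphalf k + n) ((2 * n).+1 - (uphalf k + n)).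
rewrite subnKC in h2; last lia.
have h3 := sparse_count sparse_union 0 (2 * n).+1.
rewrite !add0n in h1 h3.
(* [A] and [C] are disjoint, so their counts add up inside the sparse union. *)
have : (\sum_(0 <= i < (2 * n).+1) A i +
  \sum_(odd k <= i < odd k + 2 * n) C i <=
  \sum_(0 <= i < (2 * n).+1) (A i || C i))%N.
  apply: (@leq_trans (\sum_(0 <= i < (2 * n).+1) (A i + C i))).
    rewrite big_split leq_add2l.
    rewrite (@sum_nat_cat C 0 (odd k)) //; last by case: (odd k).
    have h : (odd k + 2 * n <= (2 * n).+1)%N by case: (odd k).
    by rewrite (sum_nat_cat _ (leq_addr _ _) h) addnCA leq_addr.
  apply: leq_sum => i _; case Ai: (A i); case Ci : (C i) => //.
  by have [] := AC Ai Ci; lia.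
lia.
Qed.

End three_rows.

(** The last block may overshoot the interval, by at most two indices since [k <= 3]; this is the
    [+ 2]. *)
Lemma block_sum_le (F : nat -> nat) (c : nat) :
  (forall t, exists k, (0 < k <= 3)%N /\ (\sum_(t <= i < t + k) F i <= k * c)%N) ->
  forall t m, (\sum_(t <= i < t + m) F i <= (m + 2) * c)%N.
Proof.
move=> FB t m; have [N] := ubnP m.
elim: N m t => // N IH m t mN; case: m mN => [|m] mN.
  by rewrite addn0 big_geq.
have [k [k03 Fk]] := FB t; have [km|mk] := leqP k m.+1.
  rewrite (@sum_nat_cat _ t (t + k)); [|lia..].
  have := IH (m.+1 - k)%N (t + k)%N ltac:(lia).
  rewrite -addnA subnKC//; nia.
move: Fk; rewrite (@sum_nat_cat _ t (t + m.+1)); [|lia..].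
nia.
Qed.

(** * Greedy grouping of rows into blocks *)

Section rows.
Variable A : nat -> pred nat.
Hypothesis no_three : forall t i, A t i -> A t i.+1 -> A t i.+2 -> False.
Hypothesis pair_above : forall t i j, A t i -> A t i.+1 -> ~~ A t.+1 j.
Hypothesis pair_above2 : forall t i j, A t i -> A t i.+1 -> ~~ A t.+2 j.
Hypothesis gap_above : forall t i j, A t i -> A t i.+2 -> ~~ A t.+1 j.
Hypothesis pair_below : forall t i j, A t.+1 i -> A t.+1 i.+1 -> ~~ A t j.
Hypothesis gap_below : forall t i j, A t.+1 i -> A t.+1 i.+2 -> ~~ A t j.
Hypothesis three_lines : forall t i j k, A t i -> A t.+1 j -> A t.+2 k ->
  (i + k + 3 <= 2 * j)%N \/ (2 * j + 3 <= i + k)%N.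

Let G t i := A t i && A t i.+1.
Let s N t := \sum_(0 <= i < N) (A t i : nat).
Let g N t := \sum_(0 <= i < N) (G t i : nat).

Let s_le N t : (3 * s N t <= 2 * (N + 2))%N.
Proof.
rewrite /s -[X in index_iota _ X]add0n; apply: (@sum_window_le _ 3 2) => // x.
rewrite sum_nat3.
have := @no_three t x.
by case: (A t x); case: (A t x.+1); case: (A t x.+2) => //= /(_ isT isT isT).
Qed.

(** Left ends of pairs at distance 1 or 2 would give three consecutive points. *)
Let sparseG t : sparse (G t).
Proof.
by move=> i; split; apply/negP => /andP[/andP[? ?]] /andP[? ?];
  apply: (@no_three t i).
Qed.

Let g_le N t : (3 * g N t <= N + 2)%N.
Proof. exact: (sparse_count (@sparseG t) 0). Qed.

Let empty N t : (forall i, (i < N)%N -> ~~ A t i) -> s N t = 0%N.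
Proof.
by move=> h; rewrite /s big_nat big1 // => i /h /negbTE ->.
Qed.

Let no_pair N t : (forall i, ~~ G t i) -> g N t = 0%N.
Proof. by move=> h; rewrite /g big1 // => i _; rewrite (negbTE (h i)). Qed.

Let empty_no_pair t i : (forall j, ~~ A t j) -> ~~ G t i.
Proof. by move=> h; rewrite /G (negbTE (h i)). Qed.

(** A row with a pair is followed by two empty rows, and its pairs start at least 3 apart: nine
    times their number is at most [3 * (N + 2)], the share of three rows. *)
Lemma pair_count_le N t m :
  (9 * \sum_(t <= y < t + m) \sum_(0 <= i < N) (A y i && A y i.+1)
    <= (m + 2) * (N + 2))%N.
Proof.
rewrite big_distrr; apply: block_sum_le => {}t.
have [[i Gi]|nG] := pselect (exists i, G t i); last first.
  exists 1%N; split => //; rewrite addn1 big_nat1 -/(g N t) no_pair //.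
  by move=> i; apply/negP => Gi; apply: nG; exists i.
exists 3%N; split => //.
have /andP[Ai Ai1] := Gi.
rewrite sum_nat3.
rewrite -!/(g N _) (@no_pair N t.+1) ?(@no_pair N t.+2) //.
- by rewrite /=; have := g_le N t; lia.
- by move=> j; apply: empty_no_pair => ?; exact: pair_above2 Ai Ai1.
- by move=> j; apply: empty_no_pair => ?; exact: pair_above Ai Ai1.
Qed.

Let F N t := (4 * s N t + g N t)%N.

(** The first row of a block has a pair, or a gap, or is sparse. A sparse row can weigh about
    [4 * N / 3], too much for one row, so the rows above it are brought in. *)
Lemma weighted_count_le n t m :
  (4 * (\sum_(t <= y < t + m) \sum_(0 <= i < (2 * n).+1) A y i) +
   \sum_(t <= y < t + m) \sum_(0 <= i < (2 * n).+1) (A y i && A y i.+1)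
    <= (m + 2) * (2 * n + 6))%N.
Proof.
set N := (2 * n).+1.
rewrite big_distrr -big_split; apply: (@block_sum_le (F N)) => {}t.
(* From [3 * s <= 2 * (N + 2)] and [3 * g <= N + 2] follows [4 * s + g <= 3 * (N + 2)], paid for by
   this row and the two empty ones above. *)
have [[i Gi]|nG] := pselect (exists i, G t i).
  have /andP[Ai Ai1] := Gi; exists 3%N; split => //; rewrite sum_nat3 /F.
  rewrite (@empty N t.+1) ?(@empty N t.+2); first last.
  - by move=> j _; exact: pair_above Ai Ai1.
  - by move=> j _; exact: pair_above2 Ai Ai1.
  rewrite (@no_pair N t.+1) ?(@no_pair N t.+2); first last.
  - by move=> j; apply: empty_no_pair => ?; exact: pair_above Ai Ai1.
  - by move=> j; apply: empty_no_pair => ?; exact: pair_above2 Ai Ai1.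
  by have := g_le N t; have := s_le N t; lia.
have gt0 y : (~ exists i, G y i) -> g N y = 0%N.
  by move=> h; apply: no_pair => i; apply/negP => Gi; apply: h; exists i.
have [[i [Ai Ai2]]|nD] := pselect (exists i, A t i /\ A t i.+2).
  exists 2%N; split => //; rewrite sum_nat2 /F (gt0 t)//.
  rewrite (@empty N t.+1) ?(@no_pair N t.+1); first last.
  - by move=> j _; exact: gap_above Ai Ai2.
  - by move=> j; apply: empty_no_pair => ?; exact: gap_above Ai Ai2.
  have : (2 * s N t <= 1 * (N + 1))%N.
    rewrite /s -[X in index_iota _ X]add0n.
    apply: (@sum_window_le _ 2 1) => // x.
    rewrite sum_nat2.
    by case Ax: (A t x); case Ax1: (A t x.+1) => //; case: nG; exists x;
      rewrite /G Ax.
  lia.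
have sparse_t : sparse (A t).
  move=> i; split; apply/negP; first by move=> ?; apply: nG; exists i.
  by move=> /andP[? ?]; apply: nD; exists i.
have ct := sparse_count sparse_t 0 N; rewrite -/(s N t) in ct.
have emptyP y : (~ exists2 j, (j < N)%N & A y j) -> s N y = 0%N.
  by move=> h; apply: empty => j jN; apply/negP => ?; apply: h; exists j.
(* Emptiness inside the window suffices for the count, whereas a point inside it constrains the
   whole neighbouring row. *)
have [[i iN Ai]|/emptyP e0] := pselect (exists2 i, (i < N)%N & A t i); last first.
  by exists 1%N; split => //; rewrite addn1 big_nat1 /F e0 gt0//.
(* A pair or a gap in row [t.+1] would empty row [t], which contains [i]. *)
have sparse_t1 : sparse (A t.+1).
  move=> j; split; apply/negP => /andP[hj hj'].
    by have := pair_below i hj hj'; rewrite Ai.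
  by have := gap_below i hj hj'; rewrite Ai.
have ct1 := sparse_count sparse_t1 0 N; rewrite -/(s N t.+1) in ct1.
have g1 : g N t.+1 = 0%N.
  by apply: gt0 => -[j Gj]; have [] := sparse_t1 j; rewrite -/(G t.+1 j) Gj.
have [[j jN Aj]|/emptyP e1] := pselect (exists2 j, (j < N)%N & A t.+1 j); last first.
  by exists 2%N; split => //; rewrite sum_nat2 /F g1 e1 gt0//; lia.
have [[k kN Ak]|/emptyP e2] := pselect (exists2 k, (k < N)%N & A t.+2 k); last first.
  (* Two sparse rows, weighing at most about [8 * N / 3], are spread over three rows. *)
  exists 3%N; split => //; rewrite sum_nat3 /F g1 e2 gt0//.
  rewrite (gt0 t.+2); first by lia.
  move=> [k /andP[h h']]; have := pair_below j h h'; by rewrite Aj.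
(* The point [k] of the third row limits the two sparse rows below it to about [n] points together,
   so these two already form a block. *)
exists 2%N; split => //; rewrite sum_nat2 /F g1 gt0//.
have := @sparse_pair_count _ _ k sparse_t sparse_t1 _ n _.
move=> /(_ (fun a b Aa Ab => three_lines Aa Ab Ak)) /(_ ltac:(lia)).
rewrite -/N -!/(s N _); lia.
Qed.

End rows.

Local Open Scope classical_set_scope.
Local Open Scope card_scope.
Local Open Scope ring_scope.

(** * Stable sets on lattice lines *)

(** The two vectors form a basis of the lattice; both orientations are allowed, so that either
    vector may be negated. *)
Definition unimodular (a b c d : int) : Prop :=
  a * d - b * c = 1 \/ a * d - b * c = -1.

Section stable.
Variable Q : int -> int -> Prop.

(* The case where [p - u] is the missing point is the second one for [- u]. *)
Definition stable := forall x y a b c d, unimodular a b c d ->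
  [/\ Q (x - a) (y - b) -> Q x y -> Q (x + a) (y + b) -> Q (x + c) (y + d),
      Q (x - a) (y - b) -> Q x y -> Q (x + c) (y + d) -> Q (x + a) (y + b) &
      Q (x - a) (y - b) -> Q (x + a) (y + b) -> Q (x + c) (y + d) -> Q x y].

Hypothesis stQ : stable.

Let shear a b c d k : unimodular a b c d ->
  unimodular a b (c + k * a) (d + k * b).
Proof.
by rewrite /unimodular => h;
  rewrite (_ : _ - _ = a * d - b * c) //; ring.
Qed.

Let opp2 a b c d : unimodular a b c d -> unimodular a b (- c) (- d).
Proof. by rewrite /unimodular; lia. Qed.

Let opp1 a b c d : unimodular a b c d -> unimodular (- a) (- b) c d.
Proof. by rewrite /unimodular; lia. Qed.

Let line a b x y := forall k, Q (x + k * a) (y + k * b).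

(** Three consecutive points are the base of a border triangle whose apex can be any point of the
    adjacent line, reached by shearing [(c, d)] along [(a, b)]. *)
Let line_step x y a b c d : unimodular a b c d ->
  Q (x - a) (y - b) -> Q x y -> Q (x + a) (y + b) -> line a b (x + c) (y + d).
Proof.
move=> h q1 q2 q3 k; have [+ _ _] := stQ x y (shear k h).
by rewrite !addrA; apply.
Qed.

Let line_next x y a b c d : unimodular a b c d ->
  line a b x y -> line a b (x + c) (y + d).
Proof.
move=> h l; apply: line_step => //.
- by have := l (-1); rewrite !mulN1r.
- by have := l 0; rewrite !mul0r !addr0.
- by have := l 1; rewrite !mul1r.
Qed.

Let line_nat x y a b c d (j : nat) : unimodular a b c d ->
  line a b x y -> line a b (x + j%:Z * c) (y + j%:Z * d).
Proof.
move=> h l; elim: j => [|j /(line_next h)]; first by rewrite !mul0r !addr0.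
rewrite (_ : x + _ + _ = x + j.+1%:Z * c); last by lia.
by rewrite (_ : y + _ + _ = y + j.+1%:Z * d); last by lia.
Qed.

(** An adjacent line gets filled, it fills the line of the given points in turn, and from there all
    lines on both sides follow one by one. *)
Lemma stable_full x y a b c d : unimodular a b c d ->
  Q (x - a) (y - b) -> Q x y -> Q (x + a) (y + b) -> forall X Y, Q X Y.
Proof.
move=> h q1 q2 q3 X Y.
have l0 : line a b x y.
  have := line_next (opp2 h) (line_step h q1 q2 q3).
  by rewrite !addrK.
have full j k : Q (x + j * c + k * a) (y + j * d + k * b).
  case: j => j; first exact: line_nat.
  by have := line_nat j.+1 (opp2 h) l0 k; rewrite NegzE !mulrN !mulNr.
(* Cramer's rule gives the coordinates of [(X - x, Y - y)] in the basis [(c, d)], [(a, b)], with the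
   sign of the determinant. *)
case: h => h.
  have := full (a * (Y - y) - b * (X - x)) (d * (X - x) - c * (Y - y)).
  rewrite (_ : x + _ + _ = x + (X - x) * (a * d - b * c)); last by ring.
  rewrite (_ : y + _ + _ = y + (Y - y) * (a * d - b * c)); last by ring.
  by rewrite h !mulr1 !subrKC.
have := full (- (a * (Y - y) - b * (X - x))) (- (d * (X - x) - c * (Y - y))).
rewrite (_ : x + _ + _ = x - (X - x) * (a * d - b * c)); last by ring.
rewrite (_ : y + _ + _ = y - (Y - y) * (a * d - b * c)); last by ring.
by rewrite h !mulrN !mulr1 !opprK !subrKC.
Qed.

Hypothesis properQ : ~ forall x y, Q x y.

Let double (x a : int) : x + a + a = x + 2 * a. Proof. by lia. Qed.

Lemma no_three_consecutive x y a b c d : unimodular a b c d ->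
  Q x y -> Q (x + a) (y + b) -> Q (x + 2 * a) (y + 2 * b) -> False.
Proof.
move=> h q1 q2 q3; apply: properQ.
apply: (@stable_full (x + a) (y + b) a b c d) => //; rewrite ?addrK//.
by rewrite !double.
Qed.

(** Together with the apex the pair would force the point [(x - a, y - b)], completing three
    consecutive points. *)
Lemma pair_excl1 x y a b c d : unimodular a b c d ->
  Q x y -> Q (x + a) (y + b) -> ~ Q (x + c) (y + d).
Proof.
move=> h q1 q2 q3; have [_ + _] := stQ x y (opp1 h).
rewrite !opprK => /(_ q2 q1 q3) q0; apply: properQ.
exact: (@stable_full x y a b c d).
Qed.

(** The two ends of the base and the apex would force the midpoint of the base. *)
Lemma gap_excl1 x y a b c d : unimodular a b c d ->
  Q x y -> Q (x + 2 * a) (y + 2 * b) -> ~ Q (x + a + c) (y + b + d).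
Proof.
move=> h q1 q2 q3; have [_ _] := stQ (x + a) (y + b) h.
rewrite !addrK => /(_ q1).
rewrite !double => /(_ q2 q3) q.
exact: no_three_consecutive h q1 q q2.
Qed.

(* If [k] is even the third point is at an even distance from the first one,
   otherwise from the second one; the remaining point of the pair then lies on a
   line adjacent to the resulting gap. *)
Lemma pair_excl2 x y a b c d k : unimodular a b c d ->
  Q x y -> Q (x + a) (y + b) -> ~ Q (x + 2 * c + k * a) (y + 2 * d + k * b).
Proof.
move=> h q1 q2 q3.
have [j [kj|kj]] : exists j : int, k = 2 * j \/ k = 2 * j + 1.
  by exists (k %/ 2)%Z; lia.
- pose c' := c + j * a; pose d' := d + j * b.
  have h' : unimodular c' d' (a - c') (b - d').
    by move: (shear j h); rewrite -/c' -/d' /unimodular; lia.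
  have e1 : x + 2 * c + k * a = x + 2 * c' by rewrite /c' kj; ring.
  have e2 : y + 2 * d + k * b = y + 2 * d' by rewrite /d' kj; ring.
  rewrite e1 e2 in q3; apply: (gap_excl1 h' q1 q3).
  rewrite (_ : x + _ + _ = x + a); last by ring.
  by rewrite (_ : y + _ + _ = y + b); last by ring.
- pose c' := c + j * a; pose d' := d + j * b.
  have h' : unimodular c' d' (- a - c') (- b - d').
    by move: (shear j h); rewrite -/c' -/d' /unimodular; lia.
  have e1 : x + 2 * c + k * a = x + a + 2 * c' by rewrite /c' kj; ring.
  have e2 : y + 2 * d + k * b = y + b + 2 * d' by rewrite /d' kj; ring.
  rewrite e1 e2 in q3; apply: (gap_excl1 h' q2 q3).
  rewrite (_ : x + a + _ + _ = x); last by ring.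
  by rewrite (_ : y + b + _ + _ = y); last by ring.
Qed.

Let um10 k : unimodular 1 0 k 1. Proof. by rewrite /unimodular; lia. Qed.
Let um10N k : unimodular 1 0 k (-1). Proof. by rewrite /unimodular; lia. Qed.

Lemma row_no_three x y : Q x y -> Q (x + 1) y -> Q (x + 2) y -> False.
Proof.
by have := @no_three_consecutive x y 1 0 0 1 (um10 0); rewrite mulr0 mulr1 !addr0.
Qed.

Lemma row_pair_above x y z : Q x y -> Q (x + 1) y -> ~ Q z (y + 1).
Proof.
have := @pair_excl1 x y 1 0 (z - x) 1 (um10 _).
by rewrite addr0 subrKC.
Qed.

Lemma row_pair_below x y z : Q x (y + 1) -> Q (x + 1) (y + 1) -> ~ Q z y.
Proof.
have := @pair_excl1 x (y + 1) 1 0 (z - x) (-1) (um10N _).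
by rewrite addr0 subrKC addrK.
Qed.

Lemma row_pair_above2 x y z : Q x y -> Q (x + 1) y -> ~ Q z (y + 2).
Proof.
have := @pair_excl2 x y 1 0 0 1 (z - x) (um10 _).
by rewrite !mulr0 !mulr1 !addr0 subrKC.
Qed.

Lemma row_gap_above x y z : Q x y -> Q (x + 2) y -> ~ Q z (y + 1).
Proof.
have := @gap_excl1 x y 1 0 (z - (x + 1)) 1 (um10 _).
by rewrite mulr0 mulr1 !addr0 subrKC.
Qed.

Lemma row_gap_below x y z : Q x (y + 1) -> Q (x + 2) (y + 1) -> ~ Q z y.
Proof.
have := @gap_excl1 x (y + 1) 1 0 (z - (x + 1)) (-1) (um10N _).
by rewrite mulr0 mulr1 !addr0 subrKC addrK.
Qed.

(** Up to sign, [e] is the determinant of the vectors from the middle point to the other two, so its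
    absolute value is the lattice distance of the lowest point from the line through the upper two.
    At distance 0 the three points are consecutive; distances 1 and 2 are excluded next to a
    pair. *)
Lemma three_rows_far x0 x1 x2 y : Q x0 y -> Q x1 (y + 1) -> Q x2 (y + 2) ->
  x0 + x2 + 3 <= 2 * x1 \/ 2 * x1 + 3 <= x0 + x2.
Proof.
move=> q0 q1 q2; set e := x0 + x2 - 2 * x1.
suff : ~ (e = 0 \/ (e = 1 \/ e = -1) \/ (e = 2 \/ e = -2)) by lia.
have um c : c = 1 \/ c = -1 -> unimodular (x2 - x1) 1 c 0.
  by rewrite /unimodular; lia.
have q2' : Q (x1 + (x2 - x1)) (y + 1 + 1) by rewrite subrKC -addrA.
case=> [e0|[e1|e2]].
- apply: (@no_three_consecutive x0 y (x1 - x0) 1 1 0).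
  + by rewrite /unimodular; lia.
  + by [].
  + by rewrite subrKC.
  + by rewrite (_ : x0 + _ = x2) ?mulr1//; lia.
- apply: (@pair_excl1 x1 (y + 1) (x2 - x1) 1 (e - (x2 - x1)) (-1)) => //.
    by rewrite /unimodular; lia.
  by rewrite addrK (_ : x1 + _ = x0)//; lia.
- have [c [ec c1]] : exists c : int, e = 2 * c /\ (c = 1 \/ c = -1).
    by case: e2 => ->; [exists 1|exists (-1)]; lia.
  apply: (@pair_excl2 x1 (y + 1) (x2 - x1) 1 c 0 (-1) (um _ c1)) => //.
  by rewrite mulr0 addr0 addrK (_ : x1 + _ + _ = x0)//; lia.
Qed.

End stable.

(** * Border triangles *)

Lemma card_eq_seq (T : choiceType) (s : seq T) :
  uniq s -> [set` s] #= `I_(size s).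
Proof.
move=> us; rewrite (_ : [set` s] = [set` seq_fset tt s]).
  by apply/card_eq_fsetP; rewrite size_seq_fset undup_id.
by apply: eq_set => z; rewrite seq_fsetE.
Qed.

Lemma convex_set_conv (R : realType) (C : set (R * R)) x y t :
  convex_set C -> C x -> C y -> 0 <= t -> t <= 1 ->
  C (t *: x + (1 - t) *: y).
Proof.
move=> cC Cx Cy t0 t1.
have t01 : Itv.spec (@Itv.num_sem R) (Itv.Real `[0, 1]%Z) t.
  by rewrite /Itv.spec/= /Itv.num_sem num_real/= in_itv/= t0 t1.
have := cC x y (Itv.mk t01).
by rewrite !inE; apply.
Qed.

Lemma convex_convex_hull (R : realType) (A : set (R * R)) :
  convex_set (convex_hull A).
Proof.
move=> x y l; rewrite !inE => hx hy C [cC AC].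
apply/set_mem/cC; apply/mem_set; [exact: hx|exact: hy].
Qed.

Lemma collinear_det (R : realType) (a b c : Z2) : collinear (vertices R a b c) ->
  (b.1 - a.1) * (c.2 - a.2) - (b.2 - a.2) * (c.1 - a.1) = 0.
Proof.
move=> [p [d [_ vd]]].
have hv q : [set a; b; c] q -> exists t : R,
    q.1%:~R = p.1 + t * d.1 /\ q.2%:~R = p.2 + t * d.2.
  move=> hq; have [|t _ e] := vd (embZ2 R q); first by exists q.
  by exists t; move: e => /(congr1 (fun z => (z.1, z.2))) [<- <-].
have [ta [a1 a2]] := hv a (or_introl (or_introl erefl)).
have [tb [b1 b2]] := hv b (or_introl (or_intror erefl)).
have [tc [c1 c2]] := hv c (or_intror erefl).
apply/eqP; rewrite -(intr_eq0 R) !rmorphB/= !rmorphM/= !rmorphB/=.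
by rewrite a1 a2 b1 b2 c1 c2; apply/eqP; ring.
Qed.

Section border.
Variables (R : realType) (x y a b c d e : int).
Hypothesis um : unimodular a b c d.

Hypothesis eE : e = a * d - b * c.

Let T : set Z2 :=
  [set` [:: (x - a, y - b); (x, y); (x + a, y + b); (x + c, y + d)]].

Let D := convex_hull (vertices R (x - a, y - b) (x + a, y + b) (x + c, y + d)).

(** The determinant [e] is its own inverse, so multiplying by it replaces division in the
    coordinates below. *)
Let e2 : e * e = 1. Proof. by case: um; rewrite eE => ->. Qed.

(* [ht z] and [ab z] are the coordinates of [z - (x, y)] in the basis
   [(c, d), (a, b)]. *)
Let ht (z : R * R) : R :=
  e%:~R * (a%:~R * (z.2 - y%:~R) - b%:~R * (z.1 - x%:~R)).
Let ab (z : R * R) : R :=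
  e%:~R * (d%:~R * (z.1 - x%:~R) - c%:~R * (z.2 - y%:~R)).

(** In these coordinates the triangle has its base from -1 to 1 at height 0 and its apex at height
    1; [K] is cut out by the three sides. *)
Let K : set (R * R) :=
  [set z | [/\ 0 <= ht z, ht z + ab z <= 1 & ht z - ab z <= 1]].

Let eR : e%:~R * (a%:~R * d%:~R - b%:~R * c%:~R) = 1 :> R.
Proof. by rewrite -!intrM -intrB -intrM -eE e2. Qed.

Let pt (s t : R) : R * R :=
  (x%:~R + s * a%:~R + t * c%:~R, y%:~R + s * b%:~R + t * d%:~R).

Let htE s t : ht (pt s t) = t.
Proof. by rewrite -[RHS]mulr1 -eR /ht /=; ring. Qed.

Let abE s t : ab (pt s t) = s.
Proof. by rewrite -[RHS]mulr1 -eR /ab /=; ring. Qed.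

Let DK : D `<=` K.
Proof.
apply: smallest_sub.
  move=> z w l; rewrite !inE /K/= => -[z1 z2 z3] [w1 w2 w3].
  set q := conv _ _ _.
  have l0 : 0 <= l%:num by [].
  have l1 : l%:num <= 1 by [].
  have q1 : q.1 = l%:num * z.1 + (1 - l%:num) * w.1 by [].
  have q2 : q.2 = l%:num * z.2 + (1 - l%:num) * w.2 by [].
  have hq : ht q = l%:num * ht z + (1 - l%:num) * ht w.
    by rewrite /ht q1 q2; ring.
  have aq : ab q = l%:num * ab z + (1 - l%:num) * ab w.
    by rewrite /ab q1 q2; ring.
  rewrite hq aq; split; nra.
have Kst (s t : R) : 0 <= t -> t + s <= 1 -> t - s <= 1 -> K (pt s t).
  by rewrite /K/= htE abE.
move=> _ [q + <-] => -[[->|->]|->].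
- have -> : embZ2 R (x - a, y - b) = pt (-1) 0.
    by rewrite /embZ2 /pt/= !intrB; congr pair; ring.
  by apply: Kst; lra.
- have -> : embZ2 R (x + a, y + b) = pt 1 0.
    by rewrite /embZ2 /pt/= !intrD; congr pair; ring.
  by apply: Kst; lra.
- have -> : embZ2 R (x + c, y + d) = pt 0 1.
    by rewrite /embZ2 /pt/= !intrD; congr pair; ring.
  by apply: Kst; lra.
Qed.

Let Dv q : [set (x - a, y - b); (x + a, y + b); (x + c, y + d)] q ->
  D (embZ2 R q).
Proof. by move=> hq; apply: sub_gen_smallest; exists q. Qed.

Let DM : D (embZ2 R (x, y)).
Proof.
have := convex_set_conv (t := 2^-1) (@convex_convex_hull R _)
  (Dv (or_introl (or_introl erefl))) (Dv (or_introl (or_intror erefl))).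
rewrite (_ : _ + _ = embZ2 R (x, y)); first by apply; lra.
rewrite [LHS]surjective_pairing; congr pair.
  transitivity (2^-1 * (x - a)%:~R + (1 - 2^-1) * (x + a)%:~R : R) => //.
  by rewrite intrB intrD; field.
transitivity (2^-1 * (y - b)%:~R + (1 - 2^-1) * (y + b)%:~R : R) => //.
by rewrite intrB intrD; field.
Qed.

Let latticeD : lattice_points D = T.
Proof.
apply/seteqP; split => q.
- move=> /DK [k1 k2 k3].
  (* Lattice points have integer coordinates in a unimodular basis, and only four integer pairs
     satisfy the inequalities of [K]. *)
  pose h := e * (a * (q.2 - y) - b * (q.1 - x)).
  pose s := e * (d * (q.1 - x) - c * (q.2 - y)).
  have hh : ht (embZ2 R q) = h%:~R.
    by rewrite /h !(intrM, intrB).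
  have ss : ab (embZ2 R q) = s%:~R.
    by rewrite /s !(intrM, intrB).
  move: k1 k2 k3; rewrite hh ss -intrD -intrB !ler0z !lerz1 => k1 k2 k3.
  have q1 : q.1 = x + s * a + h * c.
    transitivity (x + (e * e) * (q.1 - x)); first by rewrite e2; ring.
    by rewrite /s /h {1}eE; ring.
  have q2 : q.2 = y + s * b + h * d.
    transitivity (y + (e * e) * (q.2 - y)); first by rewrite e2; ring.
    by rewrite /s /h {1}eE; ring.
  rewrite (surjective_pairing q) q1 q2 /T/= !inE !xpair_eqE.
  have : (h = 0 /\ s = -1) \/ (h = 0 /\ s = 0) \/ (h = 0 /\ s = 1)
      \/ (h = 1 /\ s = 0) by clear -k1 k2 k3; lia.
  by move=> [|[|[|]]] [-> ->]; rewrite !(mul0r, mul1r, mulN1r, addr0) !eqxx ?orbT.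
- rewrite /T/= !inE => /or4P[] /eqP ->.
  + by apply: Dv; left; left.
  + exact: DM.
  + by apply: Dv; left; right.
  + by apply: Dv; right.
Qed.

Let uniqT : uniq [:: (x - a, y - b); (x, y); (x + a, y + b); (x + c, y + d)].
Proof.
rewrite /= !inE !xpair_eqE !negb_or !negb_and; move: um; rewrite /unimodular.
nia.
Qed.

Let boundaryM : boundary D (embZ2 R (x, y)).
Proof.
split; first exact: subset_closure.
rewrite /interior/= => /nbhs_ballP[r /= r0 rD].
(* Moving from the midpoint of the base by [- (r / m)] times [(c, d)] stays in the ball, as [m]
   exceeds the absolute values of [c] and [d], but leaves [K] through its base. *)
pose m : R := 1 + `|c%:~R| + `|d%:~R|.
have m0 : 0 < m by rewrite /m ltr_wpDr// ltr_wpDr.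
have lt_r (k z : R) : `|k| < m -> `|z - (z + 0 * a%:~R + - (r / m) * k)| < r.
  move=> km; rewrite (_ : z - _ = r / m * k); last by ring.
  rewrite normrM gtr0_norm ?divr_gt0// mulrAC ltr_pdivrMr//.
  by rewrite ltr_pM2l.
have lt_r' (k z : R) : `|k| < m -> `|z - (z + 0 * b%:~R + - (r / m) * k)| < r.
  by move=> /(lt_r k z); rewrite !mul0r.
have /DK : D (pt 0 (- (r / m))).
  apply: rD; split; rewrite /ball/=.
    by apply: lt_r; rewrite /m; have := normr_ge0 (d%:~R : R); lra.
  by apply: lt_r'; rewrite /m; have := normr_ge0 (c%:~R : R); lra.
move=> []; rewrite htE oppr_ge0 => h _ _.
by have := divr_gt0 r0 m0; rewrite ltNge h.
Qed.

Lemma border_triangle_unimodular : border_triangle R T.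
Proof.
exists (x - a, y - b), (x + a, y + b), (x + c, y + d); split.
- move=> /collinear_det /=; move: um; rewrite /unimodular; lia.
- by rewrite latticeD.
- exact: (card_eq_seq uniqT).
- exists (x, y); split.
  + by rewrite /T/= !inE eqxx orbT.
  + move: uniqT; rewrite /= !inE !negb_or => /and4P[/and3P[h1 _ _] /andP[h2 h3] _ _].
    by case=> [[]|] h; [move: h1|move: h2|move: h3]; rewrite h eqxx.
  + exact: boundaryM.
Qed.

Lemma B_stable_unimodular (S : set Z2) : B_stable R S ->
  [/\ S (x - a, y - b) -> S (x, y) -> S (x + a, y + b) -> S (x + c, y + d),
      S (x - a, y - b) -> S (x, y) -> S (x + c, y + d) -> S (x + a, y + b) &
      S (x - a, y - b) -> S (x + a, y + b) -> S (x + c, y + d) -> S (x, y)].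
Proof.
move=> /(_ T border_triangle_unimodular) hS.
(* If [p] were missing and the other three present, the triangle would meet [S] in exactly three
   points; the permutation lets [p] be any of the four. *)
have main p s : perm_eq (p :: s)
    [:: (x - a, y - b); (x, y); (x + a, y + b); (x + c, y + d)] ->
    size s = 3%N -> (forall q, q \in s -> S q) -> S p.
  move=> ps s3 sS; apply: contrapT => nSp; apply: hS.
  have := uniqT; rewrite -(perm_uniq ps) /= => /andP[ps' us].
  rewrite -s3 (_ : T `&` S = [set` s]); first exact: card_eq_seq.
  apply/seteqP; split => q.
    rewrite /T /= -(perm_mem ps) inE => -[/orP[/eqP ->|//]] //.
  by move=> /= qs; split; [rewrite /T/= -(perm_mem ps) inE qs orbT|exact: sS].
split => h1 h2 h3.
- apply: (main _ [:: (x - a, y - b); (x, y); (x + a, y + b)]) => //.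
    by rewrite -(perm_rot 1).
  by move=> q; rewrite !inE => /or3P[] /eqP ->.
- apply: (main _ [:: (x - a, y - b); (x, y); (x + c, y + d)]) => //.
    by apply/permP => P /=; lia.
  by move=> q; rewrite !inE => /or3P[] /eqP ->.
- apply: (main _ [:: (x - a, y - b); (x + a, y + b); (x + c, y + d)]) => //.
    by apply/permP => P /=; lia.
  by move=> q; rewrite !inE => /or3P[] /eqP ->.
Qed.

End border.

Lemma B_stable_stable (R : realType) (S : set Z2) :
  B_stable R S -> stable (fun x y => S (x, y)).
Proof. by move=> hS x y a b c d um; exact: (B_stable_unimodular x y um erefl hS). Qed.

(** * Periodic stable sets *)

Lemma fset_set_seq (T : choiceType) (A : set T) n : A #= `I_n ->
  exists s : seq T, [/\ uniq s, size s = n & forall x, x \in s <-> A x].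
Proof.
move=> An; exists (fset_set A : seq T); split.
- exact: fset_uniq.
- exact: card_fset_set.
- move=> x; have Af : finite_set A by apply/finite_setP; exists n.
  by rewrite -[_ \in _]/(x \in fset_set A) in_fset_set// inE.
Qed.

Section minimal.
Variables (R : realType) (loc : set (R * R) -> set (R * R)) (T : set Z2).
Hypothesis Tmin : minimal_triangle_with loc T.

(** [m] is the mean of [p] and [q] with weights [k] and [l], so convexity applies; the equations are
    cleared of denominators to stay in the integers. *)
Lemma minimal_conv (p q m : Z2) (k l : nat) : T p -> T q -> (0 < k + l)%N ->
  k%:Z * p.1 + l%:Z * q.1 = (k + l)%N%:Z * m.1 ->
  k%:Z * p.2 + l%:Z * q.2 = (k + l)%N%:Z * m.2 -> T m.
Proof.
have [a [b [c [_ -> _ _]]]] := Tmin.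
move=> Dp Dq kl h1 h2; rewrite /lattice_points/=.
have kl0 : (k + l)%N%:R != 0 :> R by rewrite pnatr_eq0 -lt0n.
have := @convex_set_conv R _ _ _ (k%:R / (k + l)%N%:R)
  (@convex_convex_hull R _) Dp Dq.
rewrite (_ : _ + _ = embZ2 R m); last first.
  rewrite [LHS]surjective_pairing.
  have conv (x y z : int) : k%:Z * x + l%:Z * y = (k + l)%N%:Z * z ->
      k%:R / (k + l)%N%:R * x%:~R + (1 - k%:R / (k + l)%N%:R) * y%:~R
      = z%:~R :> R.
    move=> /(congr1 (fun i : int => i%:~R : R)).
    rewrite intrD !intrM -!pmulrn => h.
    apply: (mulfI kl0); rewrite -h natrD; rewrite natrD in kl0; field.
    by [].
  by congr pair; apply: conv.
apply; first by rewrite divr_ge0.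
by rewrite ler_pdivrMr ?ltr0n// mul1r ler_nat leq_addr.
Qed.

Lemma minimal_size_le (s : seq Z2) : uniq s -> (forall x, x \in s -> T x) ->
  (size s <= 4)%N.
Proof.
have [a [b [c [_ _ T4 _]]]] := Tmin; have [t [ut <- tT]] := fset_set_seq T4.
by move=> us sT; apply: uniq_leq_size => // x /sT /tT.
Qed.

Lemma minimal_sub (s : seq Z2) x : uniq s -> (forall x, x \in s -> T x) ->
  size s = 4%N -> T x -> x \in s.
Proof.
move=> us sT s4 Tx; apply/negPn/negP => xs.
suff : (size (x :: s) <= 4)%N by rewrite /= s4.
apply: minimal_size_le; first by rewrite /= xs us.
by move=> z; rewrite inE => /orP[/eqP ->//|]; exact: sT.
Qed.

(* The points trisecting [p, q] lie in [T], so the four points of [T] would be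
   collinear. *)
Lemma minimal_not_congr3 (p q : Z2) : T p -> T q -> p != q ->
  (p.1 = q.1 %[mod 3])%Z -> (p.2 = q.2 %[mod 3])%Z -> False.
Proof.
move=> Tp Tq pq c1 c2.
(* The congruences make this division exact, [2 * i + j] being congruent to [3 * i]. *)
pose mid1 i j : int := ((2 * i + j) %/ 3)%Z.
pose m1 : Z2 := (mid1 p.1 q.1, mid1 p.2 q.2).
pose m2 : Z2 := (mid1 q.1 p.1, mid1 q.2 p.2).
have Tm1 : T m1 by apply: (minimal_conv (k := 2) (l := 1) Tp Tq) => //=; rewrite /mid1; lia.
have Tm2 : T m2 by apply: (minimal_conv (k := 2) (l := 1) Tq Tp) => //=; rewrite /mid1; lia.
pose s := [:: p; m1; m2; q].
have sT x : x \in s -> T x by rewrite !inE => /or4P[] /eqP ->.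
have us : uniq s.
  move: pq; rewrite /s /m1 /m2 /mid1 (surjective_pairing p) (surjective_pairing q).
  rewrite /= !inE !xpair_eqE/=; lia.
have Ts x : T x -> exists k : int, 3 * (x.1 - p.1) = k * (q.1 - p.1) /\
    3 * (x.2 - p.2) = k * (q.2 - p.2).
  move=> /(minimal_sub us sT erefl); rewrite !inE => /or4P[] /eqP ->.
  - by exists 0; lia.
  - by exists 1; rewrite /m1 /mid1/=; lia.
  - by exists 2; rewrite /m2 /mid1/=; lia.
  - by exists 3; lia.
have [a [b [c [+ TD _ _]]]] := Tmin; apply.
exists (embZ2 R p), (embZ2 R q - embZ2 R p); split.
  rewrite subr_eq0 eq_sym; apply: contra pq => /eqP [] /eqP + /eqP.
  by rewrite !eqr_int => e1 e2; rewrite -pair_eqE/= /pair_eq e1 e2.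
move=> _ [x abcx <-].
have : T x by rewrite TD; apply: sub_gen_smallest; exists x.
move=> /Ts [k [k1 k2]]; exists (k%:~R / 3) => //.
have line (i j l : int) : 3 * (i - j) = k * (l - j) ->
    j%:~R + k%:~R / 3 * (l%:~R - j%:~R) = i%:~R :> R.
  move=> /(congr1 (fun i : int => i%:~R : R)).
  by rewrite !intrM !intrB => h; lra.
rewrite [LHS]surjective_pairing; congr pair; exact: line.
Qed.

(* At least two of the three midpoints are new, so [T] would have five points. *)
Lemma minimal_not_even (x y z : Z2) : uniq [:: x; y; z] ->
  (forall p, p \in [:: x; y; z] -> [/\ T p, (2 %| p.1)%Z & (2 %| p.2)%Z]) ->
  False.
Proof.
rewrite /= !inE negb_or => /and3P[/andP[xy xz] yz _] sT.
pose E (p : Z2) := (2 %| p.1)%Z /\ (2 %| p.2)%Z.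
have [Tx Ex] : T x /\ E x by have [] := sT x; rewrite ?inE ?eqxx.
have [Ty Ey] : T y /\ E y by have [] := sT y; rewrite ?inE ?eqxx ?orbT.
have [Tz Ez] : T z /\ E z by have [] := sT z; rewrite ?inE ?eqxx ?orbT.
pose mid (p q : Z2) : Z2 := (((p.1 + q.1) %/ 2)%Z, ((p.2 + q.2) %/ 2)%Z).
have Tmid p q : T p -> T q -> E p -> E q -> T (mid p q).
  move=> Tp Tq [p1 p2] [q1 q2].
  by apply: (minimal_conv (k := 1) (l := 1) Tp Tq) => //=; lia.
have midC p q : mid p q = mid q p by rewrite /mid addrC [p.2 + _]addrC.
have mid_neq p q : E p -> E q -> p != q -> p != mid p q.
  move=> [p1 p2] [q1 q2]; apply: contra => /eqP; case: p q p1 p2 q1 q2.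
  by move=> p1 p2 [q1 q2] /= ? ? ? ? [? ?]; rewrite xpair_eqE; lia.
have mid_inj p q r : E p -> E q -> E r -> q != r -> mid p q != mid p r.
  move=> [p1 p2] [q1 q2] [r1 r2]; apply: contra => /eqP.
  case: p q r p1 p2 q1 q2 r1 r2.
  by move=> p1 p2 [q1 q2] [r1 r2] /= ? ? ? ? ? ? [? ?]; rewrite xpair_eqE; lia.
have mid2 p q r : E p -> E q -> E r -> p != r -> r = mid p q -> p != mid r q.
  move=> [p1 p2] [q1 q2] [r1 r2]; case: p q r p1 p2 q1 q2 r1 r2.
  move=> p1 p2 [q1 q2] [r1 r2] /= ? ? ? ? ? ? + [? ?].
  by rewrite /mid !xpair_eqE/=; lia.
(* The midpoints of [q] with [p] and with [r] are new points unless the first is [r] or the second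
   is [p]. *)
have five p q r : T p -> T q -> T r -> E p -> E q -> E r ->
    p != q -> q != r -> p != r -> r != mid p q -> p != mid r q -> False.
  move=> Tp Tq Tr Ep Eq Er pq qr pr h1 h2.
  suff : (size [:: p; q; r; mid p q; mid r q] <= 4)%N by [].
  apply: minimal_size_le; last first.
    by move=> w; rewrite !inE => /or4P[| | |/orP[]] /eqP -> //; exact: Tmid.
  have qp : q != p by rewrite eq_sym.
  have rq : r != q by rewrite eq_sym.
  have h3 := mid_neq _ _ Ep Eq pq; have h4 := mid_neq _ _ Er Eq rq.
  have h5 : q != mid p q by rewrite midC mid_neq.
  have h6 : q != mid r q by rewrite midC mid_neq.
  have h7 : mid p q != mid r q by rewrite midC [mid r q]midC mid_inj.
  by rewrite /= !inE !negb_or pq pr qr h1 h2 h3 h4 h5 h6 h7.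
(* A point that is the midpoint of the other two is taken as the common endpoint [q]. *)
case: (eqVneq z (mid x y)) => [zxy|nzxy].
  apply: (five x z y) => //; first by rewrite eq_sym.
    by rewrite midC; apply: mid2 => //; rewrite midC.
  by rewrite midC; apply: mid2.
case: (eqVneq x (mid z y)) => [xzy|nxzy]; last exact: (five x y z).
apply: (five z x y) => //; rewrite 1?[z == _]eq_sym//.
  by rewrite midC; apply: mid2 => //; rewrite 1?eq_sym// midC.
by rewrite eq_sym midC mid2 // eq_sym.
Qed.

End minimal.

Definition even_points : set Z2 := [set p | (2 %| p.1)%Z /\ (2 %| p.2)%Z].

Definition triadic_pairs : set Z2 :=
  [set p | ((3 %| p.1)%Z \/ (3 %| p.1 - 1)%Z) /\ (3 %| p.2)%Z].

Lemma even_points_BI_stable (R : realType) : BI_stable R even_points.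
Proof.
suff h loc T : @minimal_triangle_with R loc T -> ~ (T `&` even_points #= `I_3).
  by split => T; exact: h.
move=> Tmin /fset_set_seq[[|x [|y [|z [|w l]]]] []] // us _ sT.
by apply: (minimal_not_even Tmin us) => p /sT [? []].
Qed.

(** The second coordinates agree modulo 3, so three points would need three distinct residues of the
    first coordinate, while only 0 and 1 occur. *)
Lemma triadic_pairs_BI_stable (R : realType) : BI_stable R triadic_pairs.
Proof.
suff h loc T : @minimal_triangle_with R loc T -> ~ (T `&` triadic_pairs #= `I_3).
  by split => T; exact: h.
move=> Tmin /fset_set_seq[[|x [|y [|z [|w l]]]] []] // us _ sT.
have nc p q : p \in [:: x; y; z] -> q \in [:: x; y; z] -> p != q ->
    (p.1 != q.1 %[mod 3])%Z.
  move=> /sT [Tp [_ p2]] /sT [Tq [_ q2]] pq; apply/eqP => pq1.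
  by apply: (minimal_not_congr3 Tmin Tp Tq pq pq1); lia.
have [_ [x1 _]] : (T `&` triadic_pairs) x by apply/sT; rewrite !inE eqxx.
have [_ [y1 _]] : (T `&` triadic_pairs) y by apply/sT; rewrite !inE eqxx orbT.
have [_ [z1 _]] : (T `&` triadic_pairs) z by apply/sT; rewrite !inE eqxx !orbT.
move: us; rewrite /= !inE negb_or => /and3P[/andP[xy xz] yz _].
have := nc x y; have := nc x z; have := nc y z.
rewrite !inE !eqxx !orbT => /(_ isT isT yz) + /(_ isT isT xz) + /(_ isT isT xy).
lia.
Qed.

(** * Box densities *)

Section limits.
Variables (R : realType) (u : nat -> R).
Hypothesis u01 : forall n, 0 <= u n <= 1.

Let bu : bounded_fun (u : R^o^nat).
Proof.
exists 1; split; first exact: num_real.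
move=> M M1 n _; rewrite /= ger0_norm; last by case/andP: (u01 n).
by case/andP: (u01 n) => _ /le_trans; apply; exact: ltW.
Qed.

Let ubu n : has_ubound (sdrop u n).
Proof. by exists 1 => _ [m _ <-]; case/andP: (u01 m). Qed.

Let lbu n : has_lbound (sdrop u n).
Proof. by exists 0 => _ [m _ <-]; case/andP: (u01 m). Qed.

Let sups_ge n m : (n <= m)%N -> u m <= sups u n.
Proof. by move=> nm; apply: ub_le_sup => //; exists m. Qed.

Let infs_le n m : (n <= m)%N -> infs u n <= u m.
Proof. by move=> nm; apply: ge_inf => //; exists m. Qed.

(** The upper limit of a bounded sequence is the infimum of its tail suprema, so one good tail for
    each [e] is enough. *)
Lemma limn_sup_le_near (c : R) :
  (forall e, 0 < e -> exists n0, forall n, (n0 <= n)%N -> u n <= c + e) ->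
  limn_sup u <= c.
Proof.
move=> h; rewrite limn_supE//; apply/ler_addgt0Pr => e e0.
have [n0 hn0] := h e e0; apply: (@le_trans _ _ (sups u n0)).
  by apply: ge_inf; [exact: bounded_fun_has_lbound_sups|exists n0].
by apply: ge_sup; [exists (u n0), n0 => //=|move=> _ [m /= nm <-]; exact: hn0].
Qed.

Lemma limn_sup_ge_near (c : R) :
  (forall e, 0 < e -> exists n0, forall n, (n0 <= n)%N -> c - e <= u n) ->
  c <= limn_sup u.
Proof.
move=> h; rewrite limn_supE//; apply: lb_le_inf; first by exists (sups u 0), 0%N.
move=> _ [k _ <-]; apply/ler_addgt0Pr => e e0; rewrite -lerBlDr.
have [n0 hn0] := h e e0; apply: (le_trans (hn0 (maxn n0 k) (leq_maxl _ _))).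
exact/sups_ge/leq_maxr.
Qed.

Lemma limn_inf_ge_near (c : R) :
  (forall e, 0 < e -> exists n0, forall n, (n0 <= n)%N -> c - e <= u n) ->
  c <= limn_inf u.
Proof.
move=> h; rewrite limn_infE//; apply/ler_addgt0Pr => e e0; rewrite -lerBlDr.
have [n0 hn0] := h e e0; apply: (@le_trans _ _ (infs u n0)).
  by apply: lb_le_inf; [exists (u n0), n0 => //=|move=> _ [m /= nm <-]; exact: hn0].
by apply: ub_le_sup; [exact: bounded_fun_has_ubound_infs|exists n0].
Qed.

Lemma limn_inf_near (e : R) : 0 < e ->
  exists n0, forall n, (n0 <= n)%N -> limn_inf u - e <= u n.
Proof.
move=> e0; rewrite limn_infE//.
have hs : has_sup (range (infs u)).
  by split; [exists (infs u 0), 0%N|exact: bounded_fun_has_ubound_infs].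
have [_ [n0 _ <-] hn0] := sup_adherent e0 hs.
exists n0 => n nn; apply: (le_trans (ltW hn0)); exact: infs_le.
Qed.

End limits.

Lemma near_inv_small (R : realType) (K e : R) : 0 < e ->
  exists n0, forall n, (n0 <= n)%N -> K / (2 * n).+1%:R <= e.
Proof.
move=> e0; exists (Num.truncn (K / e)) => n hn.
rewrite ler_pdivrMr// mulrC -ler_pdivrMr//.
apply/ltW/(lt_le_trans (truncnS_gt _)); by rewrite ler_nat ltnS (leq_trans hn)// leq_pmull.
Qed.

(** Shifting by [n] indexes the rows and columns of the box from 0, as the counting lemmas
    require. *)
Lemma card_box_sum (X : set Z2) n :
  #|` fset_set (X `&` box n)| =
  (\sum_(0 <= t < (2 * n).+1) \sum_(0 <= i < (2 * n).+1)
     `[< X (i%:Z - n%:Z, t%:Z - n%:Z)%R >])%N.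
Proof.
pose s : seq Z2 := [seq (i%:Z - n%:Z, t%:Z - n%:Z) | t <- iota 0 (2 * n).+1,
                                           i <- iota 0 (2 * n).+1].
have us : uniq s.
  apply: allpairs_uniq; rewrite ?iota_uniq//.
  by move=> [? ?] [? ?] _ _ /= [/addIr [->] /addIr [->]].
have ms (p : Z2) : p \in s <-> box n p.
  split; first move=> /allpairsP[[i j] [hi hj ->]].
    by move: hi hj; rewrite !mem_iota/= => hi hj; split; rewrite /= in_itv/=; lia.
  case: p => p q [/= hp hq].
  move: hp hq; rewrite !in_itv/= => hp hq.
  apply/allpairsP; exists (absz (q + n%:Z), absz (p + n%:Z)); split.
  - by rewrite mem_iota/=; lia.
  - by rewrite mem_iota/=; lia.
  - by rewrite /=; congr pair; lia.
have <- : count (fun p => `[< X p >]) s =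
  (\sum_(0 <= t < (2 * n).+1)
    \sum_(0 <= i < (2 * n).+1) `[< X (i%:Z - n%:Z, t%:Z - n%:Z)%R >])%N.
  rewrite -sum1_count big_mkcond big_allpairs_dep /index_iota !subn0.
  apply: eq_bigr => t _; apply: eq_bigr => i _.
  by case: asboolP.
move: s us ms => s us ms; rewrite -size_filter.
apply: card_fset_set; rewrite (_ : X `&` _ = [set` [seq p <- s | `[< X p >]]]).
  by apply: card_eq_seq; rewrite filter_uniq.
apply/seteqP; split => p; rewrite /= mem_filter.
  by move=> [Xp /ms ->]; rewrite andbT; exact/asboolP.
by move=> /andP[/asboolP Xp /ms].
Qed.

Lemma box_densityE (R : realType) (X : set Z2) n : box_density R X n =
  (\sum_(0 <= t < (2 * n).+1) \sum_(0 <= i < (2 * n).+1)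
     `[< X (i%:Z - n%:Z, t%:Z - n%:Z)%R >])%N%:R / (2 * n).+1%:R ^+ 2.
Proof.
rewrite /box_density card_box_sum -[box n]setTI card_box_sum; congr (_ / _).
rewrite -natrX; congr (_ *+ _).
under eq_bigr do under eq_bigr do rewrite asboolT//=.
by rewrite !sum_nat_const_nat !subn0 muln1 mulnn.
Qed.

Lemma box_density01 (R : realType) (X : set Z2) n : 0 <= box_density R X n <= 1.
Proof.
rewrite box_densityE divr_ge0// ler_pdivrMr ?exprn_gt0// mul1r -natrX ler_nat.
have h (f : nat -> nat) N c : (forall i, f i <= c)%N ->
    (\sum_(0 <= i < N) f i <= N * c)%N.
  move=> fc; rewrite -{2}[N]subn0 -sum_nat_const_nat; exact: leq_sum.
apply: (h) => t; rewrite -{2}[(2 * n).+1]muln1; apply: h => i.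
by case: asbool.
Qed.

Lemma add_div_sqr (R : fieldType) (a k x : R) : x != 0 ->
  (a + k / x) * x ^+ 2 = a * x ^+ 2 + k * x.
Proof. by move=> x0; field. Qed.

Lemma ge_sub_near (R : realType) (u : nat -> R) (c K : R) :
  (forall n, c - K / (2 * n).+1%:R <= u n) ->
  forall e, 0 < e -> exists n0, forall n, (n0 <= n)%N -> c - e <= u n.
Proof.
move=> h e /(near_inv_small K)[n0 hn0]; exists n0 => n /hn0 hn.
by apply: le_trans (h n); rewrite lerD2l lerN2.
Qed.

(** * Upper bounds for the box densities of a B-stable set *)

Section upper.
Variables (R : realType) (S : set Z2).
Hypotheses (properS : S `<` [set: Z2]) (stS : B_stable R S).

Let Q x y := S (x, y).
Let stQ : stable Q := B_stable_stable stS.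

Let properQ : ~ forall x y, Q x y.
Proof. by move=> h; apply: (properS.2) => -[x y] _; exact: h. Qed.

Variable n : nat.
(** The rows extend beyond the box, so the exclusion rules have no boundary cases and a pair may end
    just outside. *)
Let A t i := `[< S (i%:Z - n%:Z, t%:Z - n%:Z) >].

Let shift (i k : nat) : (i + k)%N%:Z - n%:Z = i%:Z - n%:Z + k%:Z.
Proof. by lia. Qed.

Let AP t i : A t i -> Q (i%:Z - n%:Z) (t%:Z - n%:Z). Proof. exact: asboolW. Qed.

Let no_three t i : A t i -> A t i.+1 -> A t i.+2 -> False.
Proof.
rewrite -(addn2 i) -(addn1 i) => /AP + /AP + /AP; rewrite !shift.
exact: (row_no_three stQ properQ).
Qed.

Let pair_above t i j : A t i -> A t i.+1 -> ~~ A t.+1 j.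
Proof.
rewrite -addn1 -(addn1 t) => /AP q1 /AP q2; apply/negP => /AP.
rewrite shift in q2; rewrite shift.
exact: (row_pair_above stQ properQ q1 q2).
Qed.

Let pair_above2 t i j : A t i -> A t i.+1 -> ~~ A t.+2 j.
Proof.
rewrite -addn1 -(addn2 t) => /AP q1 /AP q2; apply/negP => /AP.
rewrite shift in q2; rewrite shift.
exact: (row_pair_above2 stQ properQ q1 q2).
Qed.

Let gap_above t i j : A t i -> A t i.+2 -> ~~ A t.+1 j.
Proof.
rewrite -addn2 -(addn1 t) => /AP q1 /AP q2; apply/negP => /AP.
rewrite shift in q2; rewrite shift.
exact: (row_gap_above stQ properQ q1 q2).
Qed.

Let pair_below t i j : A t.+1 i -> A t.+1 i.+1 -> ~~ A t j.
Proof.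
rewrite -(addn1 i) -(addn1 t) => /AP q1 /AP q2; apply/negP => /AP.
rewrite shift in q1; rewrite !shift in q2.
exact: (row_pair_below stQ properQ q1 q2).
Qed.

Let gap_below t i j : A t.+1 i -> A t.+1 i.+2 -> ~~ A t j.
Proof.
rewrite -(addn2 i) -(addn1 t) => /AP q1 /AP q2; apply/negP => /AP.
rewrite shift in q1; rewrite !shift in q2.
exact: (row_gap_below stQ properQ q1 q2).
Qed.

Let three_lines t i j k : A t i -> A t.+1 j -> A t.+2 k ->
  (i + k + 3 <= 2 * j)%N \/ (2 * j + 3 <= i + k)%N.
Proof.
rewrite -(addn2 t) -(addn1 t) => /AP + /AP + /AP; rewrite !shift => q0 q1 q2.
have := three_rows_far stQ properQ q0 q1 q2; lia.
Qed.

Let consecutiveE t i :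
  `[< consecutive S (i%:Z - n%:Z, t%:Z - n%:Z) >] = A t i && A t i.+1.
Proof.
rewrite -(addn1 i) /A shift; apply/asboolP/andP => /=.
  by move=> [h1 h2]; split; exact/asboolP.
by move=> [/asboolP h1 /asboolP h2].
Qed.

Let consecutive_sum N : (\sum_(0 <= t < N) \sum_(0 <= i < N)
    `[< consecutive S (i%:Z - n%:Z, t%:Z - n%:Z)%R >] =
  \sum_(0 <= t < N) \sum_(0 <= i < N) (A t i && A t i.+1))%N.
Proof. by do 2 (apply: eq_bigr => ? _); rewrite consecutiveE. Qed.

Lemma consecutive_box_density_le :
  9 * box_density R (consecutive S) n <= 1 + 8 / (2 * n).+1%:R.
Proof.
rewrite box_densityE; set N := (2 * n).+1.
rewrite consecutive_sum.
have := pair_count_le no_three pair_above pair_above2 N 0 N.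
rewrite add0n -/N; set g := \sum_(0 <= _ < N) _.
rewrite -(ler_nat R) !natrM !natrD => h.
have N1 : 1 <= N%:R :> R by rewrite ler1n.
rewrite mulrA ler_pdivrMr ?exprn_gt0//.
rewrite add_div_sqr ?pnatr_eq0//.
(* The constant 8 comes from [(N + 2) * (N + 2) <= N ^ 2 + 8 * N] for [N >= 1]. *)
nra.
Qed.

Lemma weighted_box_density_le :
  4 * box_density R S n + box_density R (consecutive S) n
    <= 1 + 17 / (2 * n).+1%:R.
Proof.
rewrite !box_densityE; set N := (2 * n).+1.
rewrite consecutive_sum.
have := weighted_count_le no_three pair_above pair_above2 gap_above pair_below
  gap_below three_lines n 0 N.
rewrite add0n -/N (_ : (2 * n + 6 = N + 5)%N); last by rewrite /N; lia.
have N1 : 1 <= N%:R :> R by rewrite ler1n.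
(* Likewise [(N + 2) * (N + 5) <= N ^ 2 + 17 * N]. *)
have arith (s g : nat) : (4 * s + g <= (N + 2) * (N + 5))%N ->
    4 * (s%:R / N%:R ^+ 2) + g%:R / N%:R ^+ 2 <= 1 + 17 / N%:R :> R.
  rewrite -(ler_nat R) natrD !natrM !natrD => h.
  rewrite mulrA -mulrDl ler_pdivrMr ?exprn_gt0//.
  by rewrite add_div_sqr ?pnatr_eq0//; nra.
exact: arith.
Qed.

End upper.

Section upper_limits.
Variables (R : realType) (S : set Z2).
Hypotheses (properS : S `<` [set: Z2]) (stS : B_stable R S).

Lemma lower_consecutive_density_le : lower_consecutive_density R S <= 1 / 9.
Proof.
apply/ler_addgt0Pr => e e0; have e2 : 0 < e / 2 by lra.
have [n0 h0] := limn_inf_near (box_density01 R (consecutive S)) e2.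
have [n1 h1] := near_inv_small 8 e2.
have arith (L g k x : R) : 0 < x -> 9 * g <= 1 + k -> L - x / 2 <= g ->
    k <= x / 2 -> L <= 1 / 9 + x by lra.
exact: (arith _ _ _ _ e0 (consecutive_box_density_le properS stS _)
  (h0 _ (leq_maxl n0 n1)) (h1 _ (leq_maxr n0 n1))).
Qed.

(** For all large [n] the consecutive density is at least its lower limit minus [e], and is
    subtracted from the weighted bound. *)
Lemma upper_density_le :
  upper_density R S <= (1 - lower_consecutive_density R S) / 4.
Proof.
apply: limn_sup_le_near; first exact: box_density01.
move=> e e0.
have [n0 h0] := limn_inf_near (box_density01 R (consecutive S)) e0.
have [n1 h1] := near_inv_small 17 e0.
exists (maxn n0 n1) => n; rewrite geq_max => /andP[nn0 nn1].
have arith (L g d k x : R) : 0 < x -> 4 * d + g <= 1 + k -> L - x <= g ->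
    k <= x -> d <= (1 - L) / 4 + x by lra.
exact: (arith _ _ _ _ _ e0 (weighted_box_density_le properS stS _)
  (h0 _ nn0) (h1 _ nn1)).
Qed.

End upper_limits.

(** * Lower bounds for the densities of the two examples *)

Lemma box_density_ge_product (R : realType) (X : set Z2) (f g : pred nat)
    (c d k l n : nat) : (0 < k)%N -> (0 < l)%N -> (d <= l)%N ->
  (forall x, c <= \sum_(x <= i < x + k) f i)%N ->
  (forall x, d <= \sum_(x <= i < x + l) g i)%N ->
  (forall t i, `[< X (i%:Z - n%:Z, t%:Z - n%:Z) >] = f i && g t) ->
  c%:R / k%:R * (d%:R / l%:R) - (c + d)%N%:R / (2 * n).+1%:R
    <= box_density R X n.
Proof.
move=> k0 l0 dl fc gd Xfg; rewrite box_densityE; set N := (2 * n).+1.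
have -> : (\sum_(0 <= t < N) \sum_(0 <= i < N)
    `[< X (i%:Z - n%:Z, t%:Z - n%:Z)%R >] =
    (\sum_(0 <= i < N) f i) * \sum_(0 <= i < N) g i)%N.
  rewrite mulnC big_distrl; apply: eq_bigr => t _ /=.
  rewrite big_distrr; apply: eq_bigr => i _ /=.
  by rewrite Xfg mulnC mulnb.
have := sum_window_ge k0 fc 0 N; have := sum_window_ge l0 gd 0 N.
rewrite !add0n.
have : (\sum_(0 <= i < N) f i <= N)%N.
  rewrite -[leqRHS]muln1 -{2}[N]subn0 -sum_nat_const_nat.
  by apply: leq_sum => i _; case: (f i).
move: (\sum_(0 <= i < N) f i)%N (\sum_(0 <= i < N) g i)%N => F G.
rewrite -!(ler_nat R) !natrD !natrM => FN hG hF.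
have N1 : 1 <= N%:R :> R by rewrite ler1n.
have kR : 0 < k%:R :> R by rewrite ltr0n.
have lR : 0 < l%:R :> R by rewrite ltr0n.
have {}hF : c%:R / k%:R * N%:R <= F%:R + c%:R :> R.
  by rewrite mulrAC ler_pdivrMr// mulrDl; lra.
have {}hG : d%:R / l%:R * N%:R <= G%:R + d%:R :> R.
  by rewrite mulrAC ler_pdivrMr// mulrDl; lra.
have b1 : d%:R / l%:R <= 1 :> R by rewrite ler_pdivrMr// mul1r ler_nat.
have b0 : 0 <= d%:R / l%:R :> R by rewrite divr_ge0.
move: (c%:R / k%:R) (d%:R / l%:R) hF hG b1 b0 => a b hF hG b1 b0.
rewrite ler_pdivlMr ?exprn_gt0//.
rewrite -mulNr add_div_sqr ?pnatr_eq0//.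
have F0 : 0 <= F%:R :> R by [].
have d0 : 0 <= d%:R :> R by [].
have c0 : 0 <= c%:R :> R by [].
(* The count is [F * G]. The errors [c] and [d] of its factors are each multiplied by at most [N],
   because [b <= 1] and [F <= N]. *)
have h1 : a * N%:R * (b * N%:R) <= (F%:R + c%:R) * (b * N%:R).
  by apply: ler_wpM2r => //; rewrite mulr_ge0//; lra.
have h2 : F%:R * (b * N%:R) <= F%:R * (G%:R + d%:R) by exact: ler_wpM2l.
have h3 : c%:R * (b * N%:R) <= c%:R * N%:R.
  by apply: ler_wpM2l => //; rewrite ler_piMl//; lra.
have h4 : F%:R * d%:R <= N%:R * d%:R :> R by exact: ler_wpM2r.
rewrite expr2; nra.
Qed.

Lemma even_window (n x : nat) : (1 <= \sum_(x <= i < x + 2) (2 %| (i%:Z - n%:Z)%R)%Z)%N.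
Proof. rewrite sum_nat2; lia. Qed.

Lemma triadic_window (n x : nat) : (1 <= \sum_(x <= i < x + 3) (3 %| (i%:Z - n%:Z)%R)%Z)%N.
Proof. rewrite sum_nat3; lia. Qed.

Lemma triadic_window2 (n x : nat) : (2 <= \sum_(x <= i < x + 3)
  ((3 %| (i%:Z - n%:Z)%R)%Z || (3 %| (i%:Z - n%:Z - 1)%R)%Z))%N.
Proof. rewrite sum_nat3; lia. Qed.

Lemma even_points_proper : even_points `<` [set: Z2].
Proof. by split=> // /(_ (1, 0) I) []. Qed.

Lemma triadic_pairs_proper : triadic_pairs `<` [set: Z2].
Proof. by split=> // /(_ (0, 1) I) []. Qed.

Lemma even_points_box_density (R : realType) n :
  1 / 4 - 2 / (2 * n).+1%:R <= box_density R even_points n.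
Proof.
rewrite (_ : 1 / 4 = 1%:R / 2%:R * (1%:R / 2%:R)); last by field.
apply: (@box_density_ge_product R even_points
  (fun i => (2 %| i%:Z - n%:Z)%Z) (fun i => (2 %| i%:Z - n%:Z)%Z) 1 1 2 2 n) => //.
- exact: even_window.
- exact: even_window.
- by move=> t i; apply/asboolP/andP.
Qed.

Lemma triadic_pairs_box_density (R : realType) n :
  2 / 9 - 3 / (2 * n).+1%:R <= box_density R triadic_pairs n.
Proof.
rewrite (_ : 2 / 9 = 2%:R / 3%:R * (1%:R / 3%:R)); last by field.
apply: (@box_density_ge_product R triadic_pairs
  (fun i => (3 %| i%:Z - n%:Z)%Z || (3 %| i%:Z - n%:Z - 1)%Z)
  (fun i => (3 %| i%:Z - n%:Z)%Z) 2 1 3 3 n) => //.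
- exact: triadic_window2.
- exact: triadic_window.
- move=> t i; apply/asboolP/andP.
    by move=> [/orP h1 h2]; split.
  by move=> [/orP h1 h2]; split.
Qed.

(** A pair starts exactly at first coordinates divisible by 3, as residue 1 is followed by the
    missing residue 2. *)
Lemma triadic_pairs_consecutive_box_density (R : realType) n :
  1 / 9 - 2 / (2 * n).+1%:R <= box_density R (consecutive triadic_pairs) n.
Proof.
rewrite (_ : 1 / 9 = 1%:R / 3%:R * (1%:R / 3%:R)); last by field.
apply: (@box_density_ge_product R (consecutive triadic_pairs)
  (fun i => (3 %| i%:Z - n%:Z)%Z) (fun i => (3 %| i%:Z - n%:Z)%Z) 1 1 3 3 n) => //.
- exact: triadic_window.
- exact: triadic_window.
- move=> t i; apply/asboolP/andP.
    by move=> [[/= h1 h2] [/= h3 h4]]; split; lia.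
  by move=> [h1 h2]; split; split => //=; [left|right]; lia.
Qed.

Lemma even_points_consecutive : consecutive even_points = set0.
Proof. by apply/seteqP; split => // p [[/= ? ?] [/= ? ?]]; lia. Qed.

Lemma even_points_lower_consecutive_density (R : realType) :
  lower_consecutive_density R even_points = 0.
Proof.
rewrite /lower_consecutive_density even_points_consecutive.
rewrite (_ : box_density R set0 = fun=> 0).
  suff : (fun=> 0 : R) @ \oo --> (0 : R) by move=> /cvg_limn_inf_sup [].
  exact: cvg_cst.
by apply/funext => n; rewrite /box_density set0I fset_set0 cardfs0 mul0r.
Qed.

Theorem theorem1p2 (R : realType) :
  (forall S : set Z2, S `<` [set: Z2] -> B_stable R S ->
     lower_consecutive_density R S <= 1 / 9 /\
     upper_density R S <= (1 - lower_consecutive_density R S) / 4) /\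
  (exists S : set Z2,
     [/\ S `<` [set: Z2], BI_stable R S,
         lower_consecutive_density R S = 1 / 9 & upper_density R S = 2 / 9]) /\
  (exists S' : set Z2,
     [/\ S' `<` [set: Z2], BI_stable R S',
         lower_consecutive_density R S' = 0 & upper_density R S' = 1 / 4]).
Proof.
split; last split.
- move=> S properS stS; split.
    exact: lower_consecutive_density_le.
  exact: upper_density_le.
- have st := triadic_pairs_BI_stable R.
  have low : lower_consecutive_density R triadic_pairs = 1 / 9.
    apply/eqP; rewrite eq_le lower_consecutive_density_le//=; last 2 first.
    + exact: triadic_pairs_proper.
    + exact: st.1.
    apply: limn_inf_ge_near; first exact: box_density01.
    exact: ge_sub_near (triadic_pairs_consecutive_box_density R).
  exists triadic_pairs; split => //; first exact: triadic_pairs_proper.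
  (* With lower consecutive density 1/9 the general bound reads [(1 - 1 / 9) / 4 = 2 / 9], which the
     count of points attains. *)
  have := upper_density_le triadic_pairs_proper st.1.
  rewrite low => up; apply/eqP; rewrite eq_le; apply/andP; split; first by lra.
  apply: limn_sup_ge_near; first exact: box_density01.
  exact: ge_sub_near (triadic_pairs_box_density R).
- have st := even_points_BI_stable R.
  have low := even_points_lower_consecutive_density R.
  exists even_points; split => //; first exact: even_points_proper.
  have := upper_density_le even_points_proper st.1.
  rewrite low => up; apply/eqP; rewrite eq_le; apply/andP; split; first by lra.
  apply: limn_sup_ge_near; first exact: box_density01.
  exact: ge_sub_near (even_points_box_density R).
Qed.
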